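(* Let $(\bar{\boldsymbol{x}},\bar{\boldsymbol{y}},\bar{\boldsymbol{z}})\in\Omega$ be a local minimizer of the problem $\min\{f(\boldsymbol{x}):(\boldsymbol{x},\boldsymbol{y},\boldsymbol{z})\in\Omega\}$. Suppose that the set-valued mapping $Z$ is lower semicontinuous at $\bar{\boldsymbol{x}}$. Then $\bar{\boldsymbol{x}}$ is a local minimizer of the problem $\min\{f(\boldsymbol{x}):\boldsymbol{x}\in\hat{\mathcal{X}}\}$.
   Context: $[n]=\{1,\dots,n\}$, $[t]_+=\max\{t,0\}$. Let $S,I$ be positive integers, $\alpha\in(0,1)$, $m=\lfloor\alpha S\rfloor$. Standing assumptions: $\mathcal{X}\subseteq\mathbb{R}^d$ is compact, convex, with nonempty relative interior, contained in an open set $\mathcal{U}\subseteq\mathbb{R}^d$; $f:\mathcal{U}\to\mathbb{R}$ is continuously differentiable and convex; for each $s\in[S]$ (scenario), $g_s(\boldsymbol{x})=\max_{i\in[I]}h_{s,i}(\boldsymbol{x})$ where each $h_{s,i}:\mathbb{R}^d\to\mathbb{R}$ is continuously differentiable and convex. Let $g_{(1)}(\boldsymbol{x})\le\cdots\le g_{(S)}(\boldsymbol{x})$ be the nondecreasing rearrangement of $(g_1(\boldsymbol{x}),\dots,g_S(\boldsymbol{x}))$, $G_1(\boldsymbol{x})=\sum_{s=S-m}^{S}g_{(s)}(\boldsymbol{x})$, $G_2(\boldsymbol{x})=\sum_{s=S-m+1}^{S}g_{(s)}(\boldsymbol{x})$, $\phi=G_1-G_2$, and $\hat{\mathcal{X}}=\{\boldsymbol{x}\in\mathcal{X}:\phi(\boldsymbol{x})\le0\}$.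 $\mathcal{C}=\{\boldsymbol{z}\in\mathbb{R}^S:0\le z_s\le1\ \forall s\in[S],\ \sum_{s=1}^S z_s\ge S-m\}$, and $$\Omega=\{(\boldsymbol{x},\boldsymbol{y},\boldsymbol{z})\in\mathcal{X}\times\mathbb{R}^S_+\times\mathcal{C}:\ g_s(\boldsymbol{x})\le y_s,\ y_sz_s=0\ \ \forall s\in[S]\}.$$ With $\psi_s(\boldsymbol{x})=[g_s(\boldsymbol{x})]_+$, the set-valued mapping $Z$ on $\mathcal{X}$ is $Z(\boldsymbol{x})=\arg\min\{\sum_{s=1}^S\psi_s(\boldsymbol{x})z_s:\boldsymbol{z}\in\mathcal{C}\}$. It is lower semicontinuous at $\bar{\boldsymbol{x}}$ if for every $\boldsymbol{z}\in Z(\bar{\boldsymbol{x}})$ and every $\varepsilon>0$ there is $\rho>0$ such that for every $\boldsymbol{x}\in\mathcal{X}$ with $\|\boldsymbol{x}-\bar{\boldsymbol{x}}\|<\rho$ there is $\boldsymbol{z}'\in Z(\boldsymbol{x})$ with $\|\boldsymbol{z}'-\boldsymbol{z}\|<\varepsilon$. Local minimizers are with respect to the Euclidean norm on the corresponding spaces. *)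

(* Defs.v *)
From HB Require Import structures.
From mathcomp Require Export all_boot all_order all_algebra.
From mathcomp Require Export all_classical all_reals all_analysis.
Export Order.TTheory GRing.Theory Num.Theory.
Export numFieldNormedType.Exports.

Set Implicit Arguments.
Unset Strict Implicit.
Unset Printing Implicit Defensive.

Local Open Scope classical_set_scope.
Local Open Scope ring_scope.

(* The library's norm `|v| on row vectors is the sup norm. *)
Definition enorm (R : realType) (n : nat) (v : 'rV[R]_n) : R :=
  Num.sqrt (\sum_(i < n) v ord0 i ^+ 2).

(* Euclidean norm of R^d x R^S x R^S = R^(d + 2S). *)
Definition enorm3 (R : realType) (d S : nat)
    (p : 'rV[R]_d * 'rV[R]_S * 'rV[R]_S) : R :=
  Num.sqrt (enorm p.1.1 ^+ 2 + enorm p.1.2 ^+ 2 + enorm p.2 ^+ 2).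

Definition local_minimizer (R : realType) (V : zmodType) (nrm : V -> R)
    (A : set V) (F : V -> R) (a : V) : Prop :=
  A a /\ exists2 r : R, 0 < r &
    forall b : V, A b -> nrm (b - a) < r -> F a <= F b.

Definition affine_hull (R : realType) (d : nat) (A : set 'rV[R]_d) :
    set 'rV[R]_d :=
  [set x | exists n (c : 'I_n -> R) (p : 'I_n -> 'rV[R]_d),
    [/\ forall i, A (p i), \sum_i c i = 1 & x = \sum_i c i *: p i]].

Definition relative_interior (R : realType) (d : nat) (A : set 'rV[R]_d) :
    set 'rV[R]_d :=
  [set x | A x /\ exists2 r : R, 0 < r &
    forall y, affine_hull A y -> enorm (y - x) < r -> A y].

(* U is meant to be open. Continuity of every directional derivative is
   continuity of the gradient. *)
Definition continuously_differentiable_on (R : realType) (d : nat)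
    (U : set 'rV[R]_d) (f : 'rV[R]_d -> R) : Prop :=
  forall x, U x -> differentiable f x /\
    forall v : 'rV[R]_d, {for x, continuous (fun u => ('d f u v : R))}.

(* U is an open set that need not be convex: the convexity inequality is
   required along every segment contained in U. When U itself is convex this
   is convex_function U f. *)
Definition convex_on (R : realType) (d : nat)
    (U : set 'rV[R]_d) (f : 'rV[R]_d -> R) : Prop :=
  forall D : set 'rV[R]_d, D `<=` U -> convex_set D -> convex_function D f.

(* g_s(x) = max_i h_{s,i}(x); the maximum over the nonempty index set is
   started at the value for the first index. *)
Definition max_constraint (R : realType) (d S I : nat) (hI : (0 < I)%N)
    (h : 'I_S -> 'I_I -> 'rV[R]_d -> R) (s : 'I_S) (x : 'rV[R]_d) : R :=
  \big[Num.max/h s (Ordinal hI) x]_(i < I) h s i x.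

(* u_(k), with k ranging over 1, ..., S. *)
Definition order_stat (R : realType) (S : nat) (u : 'I_S -> R) (k : nat) : R :=
  nth 0 (sort <=%R (codom u)) k.-1.

Section Problem.
Variables (R : realType) (d S m : nat).
Variables (X : set 'rV[R]_d) (g : 'I_S -> 'rV[R]_d -> R).

Definition G1 (x : 'rV[R]_d) : R :=
  \sum_(S - m <= k < S.+1) order_stat (g^~ x) k.

Definition G2 (x : 'rV[R]_d) : R :=
  \sum_((S - m).+1 <= k < S.+1) order_stat (g^~ x) k.

Definition phi (x : 'rV[R]_d) : R := G1 x - G2 x.

Definition Xhat : set 'rV[R]_d := [set x | X x /\ phi x <= 0].

Definition Cset : set 'rV[R]_S :=
  [set z | (forall s, 0 <= z ord0 s <= 1) /\
           S%:R - m%:R <= \sum_(s < S) z ord0 s].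

Definition Omega : set ('rV[R]_d * 'rV[R]_S * 'rV[R]_S) :=
  [set p | let: (x, y, z) := p : 'rV[R]_d * 'rV[R]_S * 'rV[R]_S in
    [/\ X x, forall s, 0 <= y ord0 s, Cset z
      & forall s, g s x <= y ord0 s /\ y ord0 s * z ord0 s = 0]].

Definition psi (s : 'I_S) (x : 'rV[R]_d) : R := Num.max (g s x) 0.

Definition Zmap (x : 'rV[R]_d) : set 'rV[R]_S :=
  [set z | Cset z /\ forall w, Cset w ->
    \sum_(s < S) psi s x * z ord0 s <= \sum_(s < S) psi s x * w ord0 s].

End Problem.

Definition lower_semicontinuous_map_at (R : realType) (d S : nat)
    (X : set 'rV[R]_d) (Z : 'rV[R]_d -> set 'rV[R]_S) (xbar : 'rV[R]_d) :
    Prop :=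
  forall z, Z xbar z -> forall eps : R, 0 < eps ->
    exists2 rho : R, 0 < rho &
      forall x, X x -> enorm (x - xbar) < rho ->
        exists2 z', Z x z' & enorm (z' - z) < eps.

(* Main.v *)
From mathcomp Require Import lra.
Require Import Defs.

Set Implicit Arguments.
Unset Strict Implicit.
Unset Printing Implicit Defensive.

Local Open Scope classical_set_scope.
Local Open Scope ring_scope.

(** Write [P] for the set of scenarios satisfied at [xbar], those with
    [psi s xbar = 0].  The condition [phi x <= 0] says that at least [S - m]
    scenarios are satisfied at [x] ([phi_le0_card]); equivalently, some [z] in
    [Cset m] is complementary to [psi], that is [psi s x * z s = 0] for all [s]
    ([phi_le0P]).  For such an [x] the linear program defining [Zmap m g x] has
    value [0], so its solutions are exactly the complementary [z] in [Cset m]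
    ([Zmap_complementary]).  In particular [xbar] is feasible, with [zbar] as
    the witness.

    The indicator of [P] belongs to [Zmap m g xbar] and is positive on all of
    [P] at once.  Lower semicontinuity, applied to this single point, gives
    for every feasible [x] near [xbar] a solution [z'] which is still positive
    on [P]; complementarity then forces [psi s x = 0] on all of [P].  So no
    scenario satisfied at [xbar] becomes violated at a nearby feasible point
    ([satisfied_scenarios_persist]).

    Hence [zbar] itself remains complementary to [psi] at [x], and the point
    [(x, y, zbar)] with [y s = max (ybar s) (psi s x)] lies in [Omega]: on [P]
    one has [y s = ybar s], and off [P] one has [zbar s = 0].  By continuity of
    the [psi s] and because [psi s xbar <= ybar s], this point tends to
    [(xbar, ybar, zbar)] as [x] tends to [xbar], so local optimality in [Omega]
    gives [f xbar <= f x]. *)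

(** * Euclidean norm and continuity *)

Lemma coord_le_enorm (R : realType) (n : nat) (v : 'rV[R]_n) (i : 'I_n) :
  `|v ord0 i| <= enorm v.
Proof.
rewrite -sqrtr_sqr ler_wsqrtr // (bigD1 i) //= lerDl.
by apply: sumr_ge0 => j _; exact: sqr_ge0.
Qed.

Lemma enorm_le_sum (R : realType) (n : nat) (v : 'rV[R]_n) :
  enorm v <= \sum_i `|v ord0 i|.
Proof.
have [s0 sq_le] : 0 <= \sum_i `|v ord0 i| /\
    \sum_i v ord0 i ^+ 2 <= (\sum_i `|v ord0 i|) ^+ 2.
  elim/big_rec2: _ => [|i a b _ [b0 ab]]; first by rewrite expr0n.
  split; first by rewrite addr_ge0.
  rewrite sqrrD real_normK ?num_real // -addrA lerD2l (le_trans ab) //.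
  by rewrite lerDr mulrn_wge0 // mulr_ge0.
by rewrite -[leRHS]ger0_norm // -sqrtr_sqr ler_wsqrtr.
Qed.

Lemma enorm3_le (R : realType) (d S : nat) (u : 'rV[R]_d) (v w : 'rV[R]_S) :
  enorm3 (u, v, w) <= enorm u + enorm v + enorm w.
Proof.
have [u0 v0 w0] : [/\ 0 <= enorm u, 0 <= enorm v & 0 <= enorm w].
  by split; exact: sqrtr_ge0.
rewrite -[leRHS]ger0_norm ?addr_ge0 // -sqrtr_sqr ler_wsqrtr //=.
by nra.
Qed.

Lemma enorm_nbhs (R : realType) (n : nat) (x : 'rV[R]_n) (A : set 'rV[R]_n) :
  nbhs x A -> exists2 r : R, 0 < r & forall y, enorm (y - x) < r -> A y.
Proof.
move=> /nbhs_ballP[r /= r0 xA]; exists r => // y yx; apply: xA.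
split=> // i j; rewrite ord1 /ball /= distrC.
by apply: le_lt_trans yx; have := coord_le_enorm (y - x) j; rewrite !mxE.
Qed.

Lemma continuous_bigmax (R : realType) (T : topologicalType) (J : Type)
    (r : seq J) (F0 : T -> R) (F : J -> T -> R) (x : T) :
  {for x, continuous F0} -> (forall j, {for x, continuous (F j)}) ->
  {for x, continuous (fun t => \big[Num.max/F0 t]_(j <- r) F j t)}.
Proof.
move=> cF0 cF; elim: r => [|j r IH].
  have -> // : (fun t => \big[Num.max/F0 t]_(j <- [::]) F j t) = F0.
  by apply/funext => t; rewrite big_nil.
have -> : (fun t => \big[Num.max/F0 t]_(k <- j :: r) F k t) =
    F j \max (fun t => \big[Num.max/F0 t]_(k <- r) F k t).
  by apply/funext => t; rewrite big_cons.
exact: (@continuous_max _ _ (F j) _ x (cF j) IH).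
Qed.

Lemma psi_continuous (R : realType) (d S I : nat) (hI : (0 < I)%N)
    (h : 'I_S -> 'I_I -> 'rV[R]_d -> R) (s : 'I_S) (x : 'rV[R]_d) :
  (forall i, {for x, continuous (h s i)}) ->
  {for x, continuous (psi (max_constraint hI h) s)}.
Proof.
move=> ch; apply: (@continuous_max _ _ (max_constraint hI h s) (fun=> 0)).
  by apply: continuous_bigmax => *; exact: ch.
exact: cst_continuous.
Qed.

(** * Order statistics and feasibility *)

(** The number of entries at most [a] is the position where the sorted list
    first exceeds [a].  Order statistics are numbered from [1], list positions
    from [0], which turns a strict comparison of positions into [k <= _]. *)
Lemma order_stat_le (R : realType) (S : nat) (u : 'I_S -> R) (k : nat) (a : R) :
  (0 < k <= S)%N -> (order_stat u k <= a) = (k <= #|[pred s | (u s <= a)%R]|)%N.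
Proof.
case: k => // k /= kS; rewrite /order_stat /=.
have sorted_u : sorted <=%R (sort <=%R (codom u)) by exact: sort_le_sorted.
have <- : count (<= a) (sort <=%R (codom u)) = #|[pred s | (u s <= a)%R]|.
  by rewrite count_sort count_map -size_filter cardE enumT.
have [k_lt|k_ge] := ltnP k (count (<= a) (sort <=%R (codom u))).
  by rewrite (nth_count_le 0 sorted_u k_lt).
apply/negbTE; rewrite -ltNge; apply: nth_count_gt => //.
by rewrite k_ge size_sort size_codom card_ord.
Qed.

Section Feasibility.
Variables (R : realType) (d S m : nat) (mS : (m < S)%N).
Variables (X : set 'rV[R]_d) (g : 'I_S -> 'rV[R]_d -> R).
Implicit Types (x : 'rV[R]_d) (z : 'rV[R]_S) (s : 'I_S).

Lemma psi_ge0 s x : 0 <= psi g s x.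
Proof. by rewrite le_max lexx orbT. Qed.

Lemma psi_eq0 s x : (psi g s x == 0) = (g s x <= 0).
Proof. by rewrite eq_maxr. Qed.

(** The sums [G1] and [G2] differ by their lowest term, so [phi x] is the order
    statistic of index [S - m] of the values [g s x]; this index is at least [1]
    because [m < S]. *)
Lemma phi_le0_card x :
  (phi m g x <= 0) = (S - m <= #|[pred s | (psi g s x == 0)%R]|)%N.
Proof.
rewrite /phi /G1 /G2 big_ltn ?ltnS ?leq_subr // addrK.
rewrite order_stat_le ?subn_gt0 ?mS ?leq_subr //.
by congr (_ <= _)%N; apply: eq_card => s; rewrite !inE psi_eq0.
Qed.

Definition satisfied_indicator x : 'rV[R]_S := \row_s (psi g s x == 0)%:R.

Lemma satisfied_complementary x s :
  psi g s x * satisfied_indicator x ord0 s = 0.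
Proof. by rewrite mxE; case: eqP => [->|]; rewrite ?mul0r ?mulr0. Qed.

Lemma satisfied_Cset x : phi m g x <= 0 -> Cset m (satisfied_indicator x).
Proof.
rewrite phi_le0_card => card_ge; split=> [s|].
  by rewrite mxE; case: (_ == _); rewrite ?lexx ?ler01.
under eq_bigr do rewrite mxE.
rewrite -natr_sum -natrB 1?ltnW // ler_nat (leq_trans card_ge) //.
by rewrite -sum1_card big_mkcond leq_sum // => s _; rewrite inE; case: ifP.
Qed.

(** A complementary [z] vanishes at the violated scenarios and is at most [1]
    elsewhere, so its entries sum to at most the number of satisfied ones; the
    indicator of the satisfied scenarios attains this bound. *)
Lemma phi_le0P x :
  phi m g x <= 0 <->
  exists2 z, Cset m z & forall s, psi g s x * z ord0 s = 0.
Proof.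
split=> [x_feas|[z [z01 sum_z] compl]].
  exists (satisfied_indicator x); first exact: satisfied_Cset.
  exact: satisfied_complementary.
rewrite phi_le0_card -(ler_nat R) natrB 1?ltnW // (le_trans sum_z) //.
rewrite -sum1_card natr_sum [leRHS]big_mkcond; apply: ler_sum => s _.
rewrite inE; case: ifPn => [_|psi_neq0]; first by case/andP: (z01 s).
by have /eqP := compl s; rewrite mulf_eq0 (negbTE psi_neq0) /= => /eqP ->.
Qed.

(** The objective is a sum of nonnegative terms and has minimum [0], attained at
    the indicator of the satisfied scenarios; so [z] is optimal exactly when
    every term vanishes. *)
Lemma Zmap_complementary x z : phi m g x <= 0 ->
  Zmap m g x z <-> Cset m z /\ forall s, psi g s x * z ord0 s = 0.
Proof.
move=> x_feas; split=> -[zC z_opt]; split=> //.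
  have z0 s : 0 <= psi g s x * z ord0 s.
    by rewrite mulr_ge0 ?psi_ge0 //; case: zC => /(_ s)/andP[].
  have /eqP : \sum_s psi g s x * z ord0 s = 0.
    apply/eqP; rewrite eq_le sumr_ge0 ?andbT //.
    rewrite (le_trans (z_opt _ (satisfied_Cset x_feas))) //.
    by rewrite big1 // => s _; exact: satisfied_complementary.
  rewrite psumr_eq0 // => /allP + s => /(_ s).
  by rewrite mem_index_enum => /(_ isT)/eqP.
move=> w [w01 _]; rewrite big1 // sumr_ge0 // => s _.
by rewrite mulr_ge0 ?psi_ge0 //; case/andP: (w01 s).
Qed.

(** The indicator of the scenarios satisfied at [xbar] is the right solution to
    follow: a solution at [x] within distance [1] of it is nonzero at each of
    them, and complementarity at [x] then makes [psi s x] vanish. *)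
Lemma satisfied_scenarios_persist xbar : phi m g xbar <= 0 ->
  lower_semicontinuous_map_at X (Zmap m g) xbar ->
  exists2 r : R, 0 < r & forall x, Xhat m X g x -> enorm (x - xbar) < r ->
    forall s, psi g s xbar = 0 -> psi g s x = 0.
Proof.
move=> xbar_feas lsc.
have sat_Z : Zmap m g xbar (satisfied_indicator xbar).
  apply/Zmap_complementary => //; split; first exact: satisfied_Cset.
  exact: satisfied_complementary.
have [r r0 lsc_r] := lsc _ sat_Z 1 ltr01.
exists r => // x [xX x_feas] /(lsc_r _ xX)[z'].
move=> /(Zmap_complementary _ x_feas)[_ compl] z'_near s psi0.
have /eqP := compl s; rewrite mulf_eq0 => /orP[/eqP //|/eqP z'0].
(* otherwise [z' s = 0] while the indicator is 1 at [s]: distance at least 1 *)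
have := le_lt_trans (coord_le_enorm _ s) z'_near.
by rewrite !mxE z'0 psi0 eqxx sub0r normrN1 ltxx.
Qed.

End Feasibility.

(** * Transfer of local optimality *)

Theorem theorem4p3 (R : realType) (d S I : nat)
  (hS : (0 < S)%N) (hI : (0 < I)%N)
  (alpha : R) (halpha : 0 < alpha < 1)
  (m : nat) (hm : m = Num.truncn (alpha * S%:R))
  (X U : set 'rV[R]_d)
  (hXcompact : compact X) (hXconvex : convex_set X)
  (hXrelint : relative_interior X !=set0)
  (hUopen : open U) (hXU : X `<=` U)
  (f : 'rV[R]_d -> R)
  (hfC1 : continuously_differentiable_on U f) (hfconvex : convex_on U f)
  (h : 'I_S -> 'I_I -> 'rV[R]_d -> R)
  (hhC1 : forall s i, continuously_differentiable_on setT (h s i))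
  (hhconvex : forall s i, convex_function setT (h s i))
  (g : 'I_S -> 'rV[R]_d -> R) (hg : g = max_constraint hI h)
  (xbar : 'rV[R]_d) (ybar zbar : 'rV[R]_S)
  (hmin : local_minimizer (@enorm3 R d S) (Omega m X g)
            (fun p => f p.1.1) (xbar, ybar, zbar))
  (hlsc : lower_semicontinuous_map_at X (Zmap m g) xbar) :
  local_minimizer (@enorm R d) (Xhat m X g) f xbar.
Proof.
have mS : (m < S)%N.
  case/andP: halpha => alpha0 alpha1.
  have aS0 : 0 <= alpha * S%:R by rewrite mulr_ge0 // ltW.
  rewrite hm -(ltr_nat R) (@le_lt_trans _ _ (alpha * S%:R)) // ?truncn_le //.
  by rewrite gtr_pMl // ltr0n.
have [[xbarX ybar0 zbarC Hbar] [r r0 rmin]] := hmin.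
have g_bar s : psi g s xbar <= ybar ord0 s.
  by rewrite ge_max ybar0 andbT; case: (Hbar s).
have compl_bar s : psi g s xbar * zbar ord0 s = 0.
  have [_ /eqP] := Hbar s; rewrite mulf_eq0 => /orP[/eqP y0|/eqP ->].
    have /eqP -> : psi g s xbar == 0 by rewrite eq_le psi_ge0 -{1}y0 g_bar.
    by rewrite mul0r.
  by rewrite mulr0.
have xbar_feas : phi m g xbar <= 0 by apply/(phi_le0P mS); exists zbar.
have [r1 r1_gt0 persist] := satisfied_scenarios_persist mS xbar_feas hlsc.
have S0 : 0 < S%:R :> R by rewrite ltr0n.
(* closeness of each [psi s] making [enorm (y - ybar) <= S * e = r / 2] *)
pose e := r / 2 / S%:R.
have e0 : 0 < e by rewrite !divr_gt0.
have [r2 r2_gt0 psi_near] : exists2 r2 : R, 0 < r2 & forall x,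
    enorm (x - xbar) < r2 -> forall s, `|psi g s xbar - psi g s x| < e.
  suff psi_nbhs : \forall x \near xbar, forall s,
      `|psi g s xbar - psi g s x| < e by exact: enorm_nbhs psi_nbhs.
  apply: (@filter_forall _ _ _ (nbhs xbar)) => s.
  suff /cvgr_dist_lt : {for xbar, continuous (psi g s)} by apply.
  rewrite hg; apply: psi_continuous => i.
  by apply: differentiable_continuous; case: (hhC1 s i xbar Logic.I).
split; first by split.
exists (Num.min (r / 2) (Num.min r1 r2)).
  by rewrite !lt_min r1_gt0 r2_gt0 divr_gt0.
move=> x [xX x_feas]; rewrite !lt_min => /and3P[x_r x_r1 x_r2].
pose y : 'rV[R]_S := \row_s Num.max (ybar ord0 s) (psi g s x).
apply: (rmin (x, y, zbar)).
  split=> // s; rewrite mxE.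
    by rewrite le_max ybar0.
  split; first by rewrite !le_max lexx !orbT.
  have [psi0|psi_neq0] := eqVneq (psi g s xbar) 0.
    have -> := persist x (conj xX x_feas) x_r1 s psi0.
    by rewrite max_l //; case: (Hbar s).
  (* a scenario violated at [xbar] has [zbar s = 0], whatever [y s] is *)
  have /eqP := compl_bar s.
  by rewrite mulf_eq0 (negbTE psi_neq0) => /eqP ->; rewrite mulr0.
have y_near : enorm (y - ybar) <= r / 2.
  apply: (le_trans (enorm_le_sum _)).
  have -> : r / 2 = \sum_(s < S) e.
    by rewrite sumr_const card_ord -[e *+ S]mulr_natr divfK // gt_eqF.
  apply: ler_sum => s _; rewrite !mxE.
  have := psi_near x x_r2 s; rewrite ltr_distl => /andP[psi_lt _].
  have := g_bar s.
  have [psi_ge _|ybar_lt psi_le] := leP (psi g s x) (ybar ord0 s).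
    by rewrite subrr normr0 ltW.
  by rewrite ger0_norm; lra.
have -> : (x, y, zbar) - (xbar, ybar, zbar) = (x - xbar, y - ybar, 0)
    :> 'rV[R]_d * 'rV[R]_S * 'rV[R]_S.
  by rewrite -(subrr zbar).
apply: (le_lt_trans (enorm3_le _ _ _)).
have -> : enorm (0 : 'rV[R]_S) = 0.
  by rewrite /enorm big1 ?sqrtr0 // => s _; rewrite mxE expr0n.
by lra.
Qed.
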